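(* For each non-negative integer $f$ and each prime $p \geq f+1$, there exists a finite $p$-group of coexponent $f$ whose nilpotency class is exactly $f+1$.
   Context: For a finite $p$-group $P$ of order $p^n$ and exponent $p^e$, the coexponent of $P$ is $f(P)=n-e$. *)

(* Defs.v *)
From mathcomp Require Import all_boot all_fingroup all_solvable.

Set Implicit Arguments.
Unset Strict Implicit.
Unset Printing Implicit Defensive.

(* For a p-group P with #|P| = p ^ n and exponent P = p ^ e this is n - e.
   Since exponent P divides #|P|, we have e <= n and the subtraction is never
   truncated. *)
Definition coexponent (p : nat) (gT : finGroupType) (P : {set gT}) : nat :=
  logn p #|P| - logn p (exponent P).

(* Main.v *)
(* For f >= 1 let A = Z[x]/(x^(f+1), p x, p - x^f), of order at most p^(f+1).
   Since f < p, 1 + x has order dividing p on A, and G = A : <1 + x> has order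
   at most p^(f+2).  Elements outside A have p-th power a norm, which p kills,
   so G has exponent p^2.  The f-fold commutator of 1 in A with 1 + x is
   x^f = p <> 0, so the class exceeds f; as a group of order p^n has class less
   than n for n >= 2, the order is exactly p^(f+2) and the class is f + 1.
   G is realised in the wreath product Z/p^2 wr Z/p, with A consisting of
   functions Z/p -> Z/p^2 and x acting as the forward difference; the generator
   of A is i |-> 1 + p C(i, f). *)
From HB Require Import structures.
Require Import Defs.
From mathcomp Require Import all_boot all_fingroup all_solvable.
From mathcomp Require Import all_algebra zify.

Set Implicit Arguments.
Unset Strict Implicit.
Unset Printing Implicit Defensive.

Import GRing.Theory.

(** * The regular wreath product, realised by permutations *)

Section WreathProduct.

Local Open Scope ring_scope.

Variables V I : finZmodType.
Implicit Types (phi psi : {ffun I -> V}) (i j : I) (n : nat).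

Definition shift j phi : {ffun I -> V} := [ffun i => phi (i + j)].

Lemma shift_is_zmod_morphism j : zmod_morphism (shift j).
Proof. by move=> phi psi; apply/ffunP=> i; rewrite !ffunE. Qed.

HB.instance Definition _ j :=
  Algebra.isZmodMorphism.Build {ffun I -> V} {ffun I -> V} (shift j)
    (shift_is_zmod_morphism j).

Lemma shift0 phi : shift 0 phi = phi.
Proof. by apply/ffunP=> i; rewrite ffunE addr0. Qed.

Lemma shiftD i j phi : shift i (shift j phi) = shift (i + j) phi.
Proof. by apply/ffunP=> k; rewrite !ffunE addrA. Qed.

(** The natural faithful action of the wreath product; working inside [{perm V * I}] makes the group
    axioms free. *)
Definition wr_fun phi j (x : V * I) : V * I := (x.1 + phi x.2, x.2 + j).

Lemma wr_fun_inj phi j : injective (wr_fun phi j).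
Proof. by move=> [u i] [v k] [/= + /addIr eq_ik]; rewrite eq_ik => /addIr->. Qed.

Definition wr phi j : {perm V * I} := perm (@wr_fun_inj phi j).

Lemma wrE phi j x : wr phi j x = (x.1 + phi x.2, x.2 + j).
Proof. by rewrite permE. Qed.

Lemma wrM phi j psi k :
  (wr phi j * wr psi k)%g = wr (phi + shift j psi) (j + k).
Proof. by apply/permP=> x; rewrite permM !wrE /= !ffunE !addrA. Qed.

Lemma wr1 : wr 0 0 = 1%g.
Proof. by apply/permP=> -[u i]; rewrite perm1 wrE /= ffunE !addr0. Qed.

Lemma wr_eq1 phi j : wr phi j = 1%g -> phi = 0.
Proof.
move=> eq1; apply/ffunP=> i; have /permP/(_ (0, i)) := eq1.
by rewrite wrE perm1 /= add0r ffunE => -[].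
Qed.

Lemma wrX phi j n :
  (wr phi j ^+ n)%g = wr (\sum_(k < n) shift (j *+ k) phi) (j *+ n).
Proof.
elim: n => [|n IHn]; first by rewrite big_ord0 expg0 mulr0n wr1.
by rewrite expgSr IHn wrM big_ord_recr /= -mulrSr.
Qed.

Lemma wr0X phi n : (wr phi 0 ^+ n)%g = wr (phi *+ n) 0.
Proof.
rewrite wrX mul0rn (eq_bigr (fun=> phi)) => [|k _]; last first.
  by rewrite mul0rn shift0.
by rewrite sumr_const card_ord.
Qed.

Lemma wrV0 phi : (wr phi 0)^-1%g = wr (- phi) 0.
Proof.
by apply/eqP; rewrite eq_invg_mul wrM shift0 subrr addr0 wr1.
Qed.

Lemma wr0V j : (wr 0 j)^-1%g = wr 0 (- j).
Proof.
by apply/eqP; rewrite eq_invg_mul wrM raddf0 addr0 subrr wr1.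
Qed.

(** Taking the inverse of [wr 0 j] avoids any sign or extra shift: for [j = 1] the result is exactly
    the forward difference. *)
Lemma wr_comm phi j : [~ wr phi 0, (wr 0 j)^-1]%g = wr (shift j phi - phi) 0.
Proof.
rewrite /commg /conjg invgK wrV0 wr0V !wrM !shift0 !add0r !addr0 subrr.
by rewrite addrC.
Qed.

End WreathProduct.

(** * Forward differences and the group [diff_wr f] *)

Section Differences.

Local Open Scope ring_scope.

Variables (p : nat) (V : finZmodType).
Implicit Types (phi psi : {ffun 'Z_p -> V}) (j : 'Z_p) (f : nat).

Definition diff phi : {ffun 'Z_p -> V} := shift 1 phi - phi.

Lemma diff_is_zmod_morphism : zmod_morphism diff.
Proof.
move=> phi psi; rewrite /diff raddfB /= !opprB.
by rewrite addrACA [RHS]addrACA [- phi + _]addrC.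
Qed.

HB.instance Definition _ :=
  Algebra.isZmodMorphism.Build {ffun 'Z_p -> V} {ffun 'Z_p -> V} diff
    diff_is_zmod_morphism.

Lemma iter_diffD n phi psi :
  iter n diff (phi + psi) = iter n diff phi + iter n diff psi.
Proof. by elim: n => //= n ->; rewrite raddfD. Qed.

Lemma iter_diffB n phi psi :
  iter n diff (phi - psi) = iter n diff phi - iter n diff psi.
Proof. by elim: n => //= n ->; rewrite raddfB. Qed.

Lemma iter_diffMn n m phi : iter n diff (phi *+ m) = iter n diff phi *+ m.
Proof. by elim: n => //= n ->; rewrite raddfMn. Qed.

Lemma iter_diff_shift n j phi :
  iter n diff (shift j phi) = shift j (iter n diff phi).
Proof.
by elim: n => //= n ->; rewrite /diff raddfB /= !shiftD [1 + j]addrC.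
Qed.

Lemma iter_diff_succ n phi j :
  iter n diff phi (j + 1) = iter n diff phi j + iter n.+1 diff phi j.
Proof.
by rewrite iterS; set psi := iter n _ _; rewrite !ffunE [RHS]addrC subrK.
Qed.

Lemma diff_eq0_shift phi j : diff phi = 0 -> shift j phi = phi.
Proof.
move=> /eqP; rewrite subr_eq0 => /eqP inv1; rewrite -(natr_Zp j).
elim: (j : nat) => [|k IHk]; first by rewrite mulr0n shift0.
by rewrite mulrSr -shiftD inv1.
Qed.

(* Taylor expansion: a function is determined by its differences at 0. *)
Lemma iter_diff0_inj f phi :
  (forall k, (k < f)%N -> iter k diff phi 0 = 0) -> iter f diff phi = 0 ->
  phi = 0.
Proof.
move=> z0 zf.
have zge k : (f <= k)%N -> iter k diff phi = 0.
  move=> /subnK<-; rewrite iterD zf.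
  by elim: (k - f)%N => //= n ->; rewrite raddf0.
(* Induction on [i] for all [k] at once, since passing from [i] to [i + 1] involves the difference
   of order [k + 1]. *)
have zi i k : iter k diff phi (i%:R : 'Z_p) = 0.
  elim: i k => [|i IHi] k; last by rewrite mulrSr iter_diff_succ !IHi addr0.
  by have [/z0|/zge->] := ltnP k f; rewrite ?ffunE.
by apply/ffunP=> i; rewrite -(natr_Zp i) (zi _ 0) ffunE.
Qed.

(* For V = Z/p^2 and 0 < f < p this is Z[x]/(x^(f+1), p x, p - x^f), with x
   acting as [diff]. *)
Definition diff_mod f : {set {ffun 'Z_p -> V}} :=
  [set phi | (iter f diff phi == phi *+ p) && (diff phi *+ p == 0)].

Lemma diff_modP f phi :
  reflect (iter f diff phi = phi *+ p /\ diff phi *+ p = 0)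
          (phi \in diff_mod f).
Proof. by rewrite inE; apply: (iffP andP) => -[/eqP ? /eqP ?]. Qed.

Lemma diff_mod0 f : 0 \in diff_mod f.
Proof.
apply/diff_modP; rewrite raddf0 !mul0rn; split=> //.
by elim: f => //= f ->; rewrite raddf0.
Qed.

Lemma diff_modD f phi psi :
  phi \in diff_mod f -> psi \in diff_mod f -> phi + psi \in diff_mod f.
Proof.
move=> /diff_modP[a b] /diff_modP[c d]; apply/diff_modP.
by rewrite iter_diffD (raddfD diff) mulrnDl (mulrnDl p (diff phi)) a b c d addr0.
Qed.

Lemma diff_mod_shift f j phi : phi \in diff_mod f -> shift j phi \in diff_mod f.
Proof.
move=> /diff_modP[a b]; apply/diff_modP.
have -> : diff (shift j phi) = shift j (diff phi) := iter_diff_shift 1 j phi.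
by rewrite iter_diff_shift a -!(raddfMn (shift j)) b raddf0.
Qed.

(** As [p] kills [diff phi], the function [phi *+ p] has zero difference and is therefore
    constant. *)
Lemma shift_Mp f j phi : phi \in diff_mod f -> shift j phi *+ p = phi *+ p.
Proof.
move=> /diff_modP[_ b].
by rewrite -(raddfMn (shift j)) [LHS]diff_eq0_shift // (raddfMn diff).
Qed.

Definition diff_wr f : {set {perm V * 'Z_p}} :=
  [set wr x.1 x.2 | x in setX (diff_mod f) [set: 'Z_p]].

Lemma mem_diff_wr f phi j : phi \in diff_mod f -> wr phi j \in diff_wr f.
Proof.
move=> Aphi; apply/imsetP; exists (phi, j) => //.
by rewrite in_setX Aphi in_setT.
Qed.

Lemma diff_wr_group_set f : group_set (diff_wr f).
Proof.
apply/group_setP; split; first by rewrite -wr1 mem_diff_wr ?diff_mod0.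
move=> x y /imsetP[[phi i] /setXP[/= Aphi _] ->]
  /imsetP[[psi j] /setXP[/= Apsi _] ->] /=.
by rewrite wrM mem_diff_wr ?diff_modD ?diff_mod_shift.
Qed.

Canonical diff_wr_group f := Group (diff_wr_group_set f).

Hypothesis p_gt1 : (1 < p)%N.
Hypothesis p2V : forall v : V, v *+ (p ^ 2) = 0.

Lemma ffunMp2 phi : phi *+ (p ^ 2) = 0.
Proof. by apply/ffunP=> i; rewrite ffunMnE p2V ffunE. Qed.

(* The p-th power of [wr phi j] is a norm, which p kills since p phi is
   invariant under shifts. *)
Lemma exponent_diff_wr f : (exponent (diff_wr f) %| p ^ 2)%N.
Proof.
apply/exponentP=> _ /imsetP[[phi j] /setXP[/= Aphi _] ->].
have jp0 : j *+ p = 0 by rewrite -mulr_natr pchar_Zp ?mulr0.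
rewrite -mulnn expgM [X in (X ^+ p)%g]wrX jp0 wr0X -sumrMnl.
rewrite (eq_bigr _ (fun k _ => shift_Mp _ Aphi)) sumr_const card_ord.
by rewrite -mulrnA mulnn ffunMp2 wr1.
Qed.

(** Count Taylor coefficients at 0: the value is free in [V], the differences of orders 1 to [f] are
    killed by [p], and the higher ones are forced. The last factor counts the shifts. *)
Lemma card_diff_wr f :
  (#|diff_wr f.+1| <= #|V| * #|[set v : V | v *+ p == 0%R]| ^ f * p)%N.
Proof.
apply: leq_trans (leq_imset_card _ _) _.
rewrite cardsX cardsT card_ord Zp_cast // leq_mul2r; apply/orP; right.
pose taylor phi := (phi 0, [ffun k : 'I_f => iter k.+1 diff phi 0]).
have taylor_inj : {in diff_mod f.+1 &, injective taylor}.
  move=> phi psi /diff_modP[a b] /diff_modP[c d] [eq0 /ffunP eqk].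
  apply/eqP; rewrite -subr_eq0; apply/eqP.
  have z0 : phi 0 - psi 0 = 0 by rewrite eq0 subrr.
  apply: (@iter_diff0_inj f.+2).
    move=> [_|k]; first by rewrite /= !ffunE.
    rewrite ltnS leq_eqVlt => /predU1P[->|].
      (* In order [f.+1] the difference is [phi *+ p], so its value at 0 depends only on [phi 0]. *)
      by rewrite iter_diffB a c -mulrnBl ffunMnE !ffunE z0 mul0rn.
    rewrite ltnS => lt_kf; have := eqk (Ordinal lt_kf).
    by rewrite iter_diffB !ffunE => ->; rewrite subrr.
  (* In order [f.+2] it is [diff phi *+ p], which vanishes. *)
  by rewrite iter_diffB !(iterS f.+1) a c !(raddfMn diff) b d subrr.
rewrite -(card_in_imset taylor_inj) -cardsT.
rewrite -[X in (_ ^ X)%N](card_ord f) -card_ffun_on -cardX.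
apply/subset_leq_card/subsetP=> _ /imsetP[phi /diff_modP[_ b] ->].
rewrite inE /=; apply/andP; split; first by [].
apply/ffun_onP=> k; rewrite ffunE inE -iterS -ffunMnE iterSr -iter_diffMn b.
suff -> : iter k diff 0 = 0 by rewrite ffunE.
by elim: (k : nat) => //= n ->; rewrite raddf0.
Qed.
End Differences.

Arguments diff {p V} phi.

(** * The binomial generator over Z/p^2 *)

Section BinomialFunction.

Local Open Scope ring_scope.

Variables (f p : nat).
Hypotheses (p_prime : prime p) (f_gt0 : (0 < f)%N) (lt_fp : (f < p)%N).

Let p_gt1 : (1 < p)%N := prime_gt1 p_prime.

Lemma Zp2_gt1 : (1 < p ^ 2)%N.
Proof. by rewrite -(exp1n 2) ltn_exp2r. Qed.

Lemma Zp2_mulrn (v : 'Z_(p ^ 2)) : v *+ (p ^ 2) = 0.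
Proof. by rewrite -mulr_natr pchar_Zp ?mulr0 // Zp2_gt1. Qed.

(** The elements killed by [p] are the multiples [p * k] with [k < p]. *)
Lemma card_Zp2_ptorsion : (#|[set v : 'Z_(p ^ 2) | v *+ p == 0%R]| <= p)%N.
Proof.
rewrite -[leqRHS]card_ord -cardsT.
apply: leq_trans (leq_imset_card (fun k : 'I_p => (p * k)%:R : 'Z_(p ^ 2)) _).
apply/subset_leq_card/subsetP=> v; rewrite inE -[v in v *+ p]natr_Zp -mulrnA.
move=> /eqP/(congr1 val); rewrite /= val_Zp_nat ?Zp2_gt1 // => /eqP.
have eq_dvd n : (p ^ 2 %| n * p)%N = (p %| n)%N.
  by rewrite -mulnn dvdn_pmul2r ?prime_gt0.
rewrite -[_ == _]/(p ^ 2 %| v * p)%N eq_dvd => /dvdnP[k def_v].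
have lt_kp : (k < p)%N.
  have := ltn_ord v; rewrite [X in (_ < X)%N]Zp_cast ?Zp2_gt1 // def_v -mulnn.
  by rewrite ltn_pmul2r ?prime_gt0.
apply/imsetP; exists (Ordinal lt_kp); rewrite ?inE //=.
by rewrite mulnC -def_v natr_Zp.
Qed.

Definition binp k : {ffun 'Z_p -> 'Z_(p ^ 2)} :=
  [ffun i : 'Z_p => ('C(i, k) * p)%:R].

(* The congruence C(p, k+1) = 0 mod p is what makes this true at the
   wrap-around i = p - 1. *)
Lemma diff_binp k : (k.+1 < p)%N -> diff (binp k.+1) = binp k.
Proof.
move=> lt_kp; apply/ffunP=> i; rewrite !ffunE; apply/eqP.
(* Pascal's rule leaves only the reduction of [i + 1] modulo [p] to be dealt with. *)
rewrite subr_eq -natrD -mulnDl addnC -binS.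
have ltip : (i < p)%N by have := ltn_ord i; rewrite [X in (_ < X)%N]Zp_cast.
have -> : (i + 1 : 'Z_p) = (i.+1 %% p)%N :> nat.
  by rewrite -{1}[i]natr_Zp natr1 val_Zp_nat.
have [lt_i1p|] := ltnP i.+1 p; first by rewrite modn_small.
move=> le_pi1; have -> : i.+1 = p by apply/eqP; rewrite eqn_leq ltip.
rewrite modnn bin0n /= mul0n.
have /dvdnP[c ->] : (p %| 'C(p, k.+1))%N by rewrite prime_dvd_bin.
by rewrite -mulnA mulnn mulrnA Zp2_mulrn.
Qed.

(** Differences see only [binp f] and multiplication by [p] sees only the constant 1; both
    [iter f diff] and [*+ p] then give the constant [binp 0]. *)
Definition unip : {ffun 'Z_p -> 'Z_(p ^ 2)} := [ffun=> 1] + binp f.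

Lemma binpMp k : binp k *+ p = 0.
Proof.
by apply/ffunP=> i; rewrite ffunMnE !ffunE -mulrnA -mulnA mulnn mulrnA Zp2_mulrn.
Qed.

Lemma unipMp : unip *+ p = binp 0.
Proof.
rewrite /unip mulrnDl binpMp addr0; apply/ffunP=> i.
by rewrite ffunMnE !ffunE bin0 mul1n.
Qed.

Lemma diff_unip : diff unip = binp f.-1.
Proof.
rewrite /unip -{1}(prednK f_gt0) raddfD /= diff_binp ?prednK //.
by apply/ffunP=> i; rewrite !ffunE subrr add0r.
Qed.

Lemma iter_diff_unip : iter f diff unip = unip *+ p.
Proof.
rewrite unipMp -(prednK f_gt0) iterSr diff_unip.
have: (f.-1 < p)%N by apply: leq_ltn_trans lt_fp; rewrite leq_pred.
by elim: f.-1 => //= n IHn lt_np; rewrite -iterS iterSr diff_binp ?IHn // ltnW.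
Qed.

Lemma unip_diff_mod : unip \in diff_mod _ _ f.
Proof. by apply/diff_modP; rewrite iter_diff_unip diff_unip binpMp. Qed.

Lemma unipMp_neq0 : unip *+ p != 0.
Proof.
apply/eqP=> /ffunP/(_ 0); rewrite unipMp !ffunE bin0 mul1n => /(congr1 val).
rewrite /= val_Zp_nat ?Zp2_gt1 // modn_small => [p0|].
  by move: p_gt1; rewrite p0.
by rewrite -mulnn ltn_Pmull ?prime_gt0.
Qed.

End BinomialFunction.

(** * Exponent, order and class of the group *)

Section MaximalClass.

Variables (f p : nat).
Hypotheses (p_prime : prime p) (f_gt0 : 0 < f) (lt_fp : f < p).

Let P := diff_wr_group p 'Z_(p ^ 2) f.
Let u := unip f p.
Let p_gt1 : 1 < p := prime_gt1 p_prime.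

Lemma unip_wr_mem : wr u 0%R \in P.
Proof. exact: mem_diff_wr (unip_diff_mod p_prime f_gt0 lt_fp). Qed.

Lemma exponent_maximal_class : exponent P = p ^ 2.
Proof.
have := exponent_diff_wr p_gt1 (Zp2_mulrn p_prime) f.
rewrite -/P => /(dvdn_pfactor _ _ p_prime)[m le_m2 expP].
rewrite expP; congr (p ^ _); apply/eqP; rewrite eqn_leq le_m2 ltnNge.
apply/negP=> le_m1.
(* The element [wr u 0] does not have order dividing [p], because [u *+ p] is nonzero. *)
have /exponentP/(_ _ unip_wr_mem) : exponent P %| p ^ 1.
  by rewrite expP dvdn_exp2l.
by rewrite wr0X => /wr_eq1/eqP; rewrite (negPf (unipMp_neq0 _ _)).
Qed.

Lemma pgroup_maximal_class : p.-group%g P.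
Proof. by rewrite -pnat_exponent exponent_maximal_class pnatX pnat_id. Qed.

Lemma nil_class_gt : f < nil_class P.
Proof.
have nilP := pgroup_nil pgroup_maximal_class.
rewrite ltnNge; apply/negP=> /(lcn_nil_classP f nilP) L1.
(* Each commutator with the inverse of [wr 0 1] applies [diff] once and descends one step in the
   lower central series. *)
have iterL k : wr (iter k diff u) 0%R \in 'L_k.+1(P)%g.
  elim: k => [|k IHk]; first exact: unip_wr_mem.
  rewrite lcnSn /= -wr_comm mem_commg // groupV mem_diff_wr //.
  exact: diff_mod0.
have := iterL f; rewrite L1 => /set1P/wr_eq1/eqP.
by rewrite iter_diff_unip // (negPf (unipMp_neq0 _ _)).
Qed.

Lemma card_maximal_class_le : #|P| <= p ^ f.+2.
Proof.
have := card_diff_wr 'Z_(p ^ 2) p_gt1 f.-1.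
rewrite (prednK f_gt0) card_ord Zp_cast ?Zp2_gt1 // => /leq_trans; apply.
have le_tors : #|[set v : 'Z_(p ^ 2) | (v *+ p == 0)%R]| ^ f.-1 <= p ^ f.-1.
  (* Comparing bases needs a positive exponent; for [f = 1] both powers are 1. *)
  by case: f.-1 => // n; rewrite leq_exp2r // card_Zp2_ptorsion.
apply: leq_trans (leq_mul (leq_mul (leqnn (p ^ 2)) le_tors) (leqnn p)) _.
by rewrite -expnD -expnSr add2n prednK.
Qed.

Lemma maximal_class : logn p #|P| = f.+2 /\ nil_class P = f.+1.
Proof.
have le_f2 : logn p #|P| <= f.+2.
  rewrite -(leq_exp2l _ _ p_gt1) -(card_pgroup pgroup_maximal_class).
  exact: card_maximal_class_le.
have := nil_class_pgroup pgroup_maximal_class; have := nil_class_gt.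
(* Here [f < c] and [f > 0] give [c >= 2], so the general bound [c <= maxn 1 l.-1] becomes
   [c <= l.-1], and [l <= f.+2] closes the squeeze. *)
move: f_gt0 le_f2; set c := nil_class P; set l := logn p #|P|; lia.
Qed.

End MaximalClass.

Theorem mainTheorem2 (f p : nat) (p_prime : prime p) (le_f1_p : f + 1 <= p) :
  exists (gT : finGroupType) (P : {group gT}),
    [/\ (p.-group P)%g, coexponent p P = f & nil_class P = f + 1].
Proof.
rewrite addn1 in le_f1_p *; case: f le_f1_p => [|f] lt_fp.
  (* The construction needs [f > 0]; for [f = 0] the cyclic group of order [p] serves, being abelian
     and nontrivial. *)
  have p_gt1 := prime_gt1 p_prime.
  have cardP : #|Zp p| = p by rewrite card_Zp ?prime_gt0.
  exists _, (Zp_group p); rewrite /coexponent /= cardP.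
  have cycP : cyclic (Zp p) by rewrite prime_cyclic ?cardP.
  split; first by rewrite /pgroup cardP pnat_id.
    have [x defP] := cyclicP cycP.
    by rewrite defP exponent_cycle orderE -defP cardP subnn.
  apply/eqP; rewrite eqn_leq nil_class1 (cyclic_abelian cycP) lt0n nil_class0.
  by rewrite trivg_card1 cardP; case: p p_gt1 {p_prime lt_fp cardP cycP} => [|[]].
have [logP classP] := maximal_class p_prime (ltn0Sn f) lt_fp.
exists _, (diff_wr_group p 'Z_(p ^ 2) f.+1).
split=> //; first exact: pgroup_maximal_class.
by rewrite /coexponent logP exponent_maximal_class // pfactorK // subn2.
Qed.
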